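(* Let $J$ be a finite index set and let $f$ be a positive polynomial system (PPS) indexed by $J$. Then for all $l, u \in \mathbb{R}_{\ge 0}^J$, $$ l \le f(l) \ \wedge\ l \le u \ \wedge\ f(u) \prec u \ \implies\ l \le \mu f \prec u .$$ Moreover, if $f$ is feasible, non-singular and clean, then for all $\varepsilon > 0$ there exist $l, u \in \mathbb{Q}_{\ge 0}^J$ with $l \le f(l)$, $l \le u$, $f(u) \prec u$ and $\|l - u\|_\infty \le \varepsilon$.
   Context: A positive polynomial system (PPS) over variables $x = (x_j)_{j\in J}$, $J$ finite, is a vector $f = (f_j)_{j \in J}$ of multivariate polynomials in $x$ with coefficients in $\mathbb{R}_{\ge 0}$. It induces a monotone function $f\colon [0,\infty]^J \to [0,\infty]^J$ (with $0\cdot\infty = 0$), which has a least fixed point $\mu f \in [0,\infty]^J$ with respect to the component-wise order $\le$. For vectors, $u \prec v$ means $u_j < v_j$ for all $j \in J$. The PPS $f$ is feasible if $\mu f \in \mathbb{R}_{\ge 0}^J$, and clean if $(\mu f)_j > 0$ for all $j \in J$. $f'(u)$ denotes the Jacobi matrix $(\partial f_i/\partial x_j)_{i,j\in J}$ evaluated at $u$. A feasible PPS $f$ is non-singular if the matrix $I - f'(\mu f)$ is invertible. *)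

(* Defs.v *)
(* mpoly has to be imported before the mathcomp-analysis files: the converse
   order is rejected because of clashing notation levels. *)
From HB Require Import structures.
From mathcomp Require Import all_boot all_order all_algebra.
From mathcomp Require Import mpoly.
From mathcomp Require Import boolp classical_sets reals constructive_ereal ereal.

Set Implicit Arguments.
Unset Strict Implicit.
Unset Printing Implicit Defensive.

Import Order.TTheory GRing.Theory Num.Theory.
Local Open Scope ring_scope.

(* A family (f_j)_{j in J} of polynomials in the variables (x_j)_{j in J}.
   mpoly only offers variables indexed by an ordinal, so the variable x_j is
   'X_(enum_rank j) : {mpoly R[#|J|]}. *)
Record pps (R : realType) (J : finType) := PPS {
  pps_poly :> J -> {mpoly R[#|J|]};
  pps_ge0 : forall j m, 0 <= (pps_poly j)@_m }.

Definition vle d (T : porderType d) (J : Type) (x y : J -> T) : Prop :=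
  forall j, (x j <= y j)%O.

Definition vlt d (T : porderType d) (J : Type) (x y : J -> T) : Prop :=
  forall j, (x j < y j)%O.

Definition vnonneg (V : porderZmodType) (J : Type) (x : J -> V) : Prop :=
  forall j, 0 <= x j.

Definition vnonnege (R : realType) (J : Type) (x : J -> \bar R) : Prop :=
  forall j, (0 <= x j)%E.

Definition vEFin (R : realType) (J : Type) (x : J -> R) : J -> \bar R :=
  fun j => (x j)%:E.

Definition vratr (R : realType) (J : Type) (x : J -> rat) : J -> R :=
  fun j => ratr (x j).

(* Equal to 0 when J is empty. *)
Definition supnorm (R : realType) (J : finType) (x : J -> R) : R :=
  \big[Num.max/0]_(j : J) `|x j|.

(* The function induced by f on [0, +oo]^J; note that 0 * +oo = 0 in \bar R.
   Only the values at nonnegative arguments are meaningful. *)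
Definition pps_eval (R : realType) (J : finType) (f : pps R J)
    (x : J -> \bar R) : J -> \bar R :=
  fun j => (\sum_(m <- msupp (f j))
              ((f j)@_m)%:E * \prod_(i < #|J|) x (enum_val i) ^+ m i)%E.

Lemma pps_evalEFin (R : realType) (J : finType) (f : pps R J) (x : J -> R) j :
  pps_eval f (vEFin x) j = ((f j).@[fun i => x (enum_val i)])%:E.
Proof.
rewrite /pps_eval mevalE -sumEFin; apply: eq_bigr => m _.
rewrite EFinM -prodEFin; congr (_ * _)%E.
by apply: eq_bigr => i _; rewrite EFin_expe.
Qed.

Lemma pps_eval_ge0 (R : realType) (J : finType) (f : pps R J) x :
  vnonnege x -> vnonnege (pps_eval f x).
Proof.
move=> x0 j; apply: sume_ge0 => m _; apply: mule_ge0.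
  by rewrite lee_fin pps_ge0.
by apply: prode_ge0 => i _; exact: expe_ge0.
Qed.

Lemma pps_eval_mono (R : realType) (J : finType) (f : pps R J) x y :
  vnonnege x -> vle x y -> vle (pps_eval f x) (pps_eval f y).
Proof.
move=> x0 xy j; apply: lee_sum => m _; apply: lee_wpmul2l.
  by rewrite lee_fin pps_ge0.
have expe_mono (a b : \bar R) k :
    (0 <= a)%E -> (a <= b)%E -> (a ^+ k <= b ^+ k)%E.
  move=> a0 ab; elim: k => [|k IH]; first by rewrite !expe0.
  by rewrite !expeS; apply: lee_pmul => //; exact: expe_ge0.
have [] // : (0 <= \prod_(i < #|J|) x (enum_val i) ^+ m i)%E /\
  (\prod_(i < #|J|) x (enum_val i) ^+ m i
     <= \prod_(i < #|J|) y (enum_val i) ^+ m i)%E.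
apply: (big_ind2 (fun a b : \bar R => (0 <= a)%E /\ (a <= b)%E)) => //.
- by move=> a b c d [a0 ab] [c0 cd]; split; [exact: mule_ge0|exact: lee_pmul].
- by move=> i _; split; [exact: expe_ge0|apply: expe_mono => //; exact: xy].
Qed.

Definition is_lfp (R : realType) (J : finType) (f : pps R J)
    (x : J -> \bar R) : Prop :=
  [/\ vnonnege x, pps_eval f x = x &
      forall y, vnonnege y -> pps_eval f y = y -> vle x y].

Lemma lfp_exists (R : realType) (J : finType) (f : pps R J) :
  exists x, is_lfp f x.
Proof.
pose P := [set x | vnonnege x /\ vle (pps_eval f x) x]%classic.
pose mu j := ereal_inf [set x j | x in P]%classic.
have mu_le x : P x -> vle mu x.
  by move=> Px j; apply: ereal_inf_lbound; exists x.
have mu0 : vnonnege mu.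
  by move=> j; apply: le_ereal_inf_tmp => _ [x [x0 _] <-].
have fmu : vle (pps_eval f mu) mu.
  move=> j; apply: le_ereal_inf_tmp => _ [x Px <-].
  by apply: le_trans (Px.2 j); apply: pps_eval_mono => //; exact: mu_le.
exists mu; split => //.
  apply/funext => j; apply/le_anti; rewrite fmu /=.
  apply: mu_le; split; first exact: pps_eval_ge0.
  by apply: pps_eval_mono => //; exact: pps_eval_ge0.
by move=> y y0 fy; apply: mu_le; split => // j; rewrite fy.
Qed.

Definition mu (R : realType) (J : finType) (f : pps R J) : J -> \bar R :=
  sval (cid (lfp_exists f)).

Lemma mu_lfp (R : realType) (J : finType) (f : pps R J) : is_lfp f (mu f).
Proof. by rewrite /mu; case: cid. Qed.

Definition feasible (R : realType) (J : finType) (f : pps R J) : Prop :=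
  forall j, mu f j \is a fin_num.

Definition clean (R : realType) (J : finType) (f : pps R J) : Prop :=
  forall j, (0 < mu f j)%E.

Definition pps_jacobian (R : realType) (J : finType) (f : pps R J)
    (x : J -> R) : 'M[R]_#|J| :=
  \matrix_(i, k) ((f (enum_val i))^`M(k)).@[fun h => x (enum_val h)].

Definition nonsingular (R : realType) (J : finType) (f : pps R J) : Prop :=
  feasible f /\ 1%:M - pps_jacobian f (fun j => fine (mu f j)) \in unitmx.

(* Main.v *)
(* Part one: replace [l] by [max l (mu f)].  Along the ray from [mu f] through
   this point [f] is convex, so it stays above the ray beyond that point; at the
   parameter where the ray touches the boundary of [[0, u]] this contradicts
   [f u < u].

   Part two: let [A] be the Jacobian at [m = mu f] and [d] the solution of
   [(1 - A) d = 1].  If [d] had a negative entry, its negative part [v] would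
   satisfy [A v >= v + 1] on the support of [v], so that for small [e > 0] the
   vector [m - e v] would be a pre-fixed point below [m], contradicting
   leastness (no Perron-Frobenius theory is needed).  Hence [d >= 1], and as
   [A d = d - 1] the points [m - e d] and [m + e d] leave enough room for
   rational [l] and [u]. *)
Require Import Defs.
From HB Require Import structures.
From mathcomp Require Import all_boot all_order all_algebra.
From mathcomp Require Import mpoly.
From mathcomp Require Import boolp classical_sets reals constructive_ereal ereal.
From mathcomp Require Import ring lra.
Import Order.TTheory GRing.Theory Num.Theory.
Local Open Scope ring_scope.

(** * Polynomial evaluation along a line *)

(** Expanding [p] into monomials uses only its own coefficients as constants, so a sign condition
    [S] survives the induction. *)
Lemma mpoly_semiring_ind {R : comNzRingType} {n : nat} (S : R -> Prop)
    (P : {mpoly R[n]} -> Prop) :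
  P 0 -> P 1 -> (forall c, S c -> P c%:MP) -> (forall i, P 'X_i) ->
  (forall p q, P p -> P q -> P (p + q)) ->
  (forall p q, P p -> P q -> P (p * q)) ->
  forall p, (forall m, S p@_m) -> P p.
Proof.
move=> P0 P1 PC PX PD PM p Sp; rewrite (mpolyE p).
apply: big_ind => // m _; rewrite -mul_mpolyC mpolyXE_id.
apply: (PM); first exact: PC.
apply: (big_ind P P1 PM) => i _; elim: (m i) => [|k IH]; first by rewrite expr0.
by rewrite exprS; exact: PM.
Qed.

(** Along a line the remainder is [e ^+ 2] times a polynomial in [e], hence easy to bound near 0.
    The product case is the Leibniz rule. *)
Lemma meval_taylor1 {R : realFieldType} {n : nat} (x d : 'I_n -> R)
    (p : {mpoly R[n]}) :
  exists q : {poly R}, forall e : R,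
    p.@[fun i => x i + e * d i] =
      p.@[x] + e * (\sum_k p^`M(k).@[x] * d k) + e ^+ 2 * q.[e].
Proof.
pose P (p : {mpoly R[n]}) := exists q : {poly R}, forall e : R,
  p.@[fun i => x i + e * d i] =
    p.@[x] + e * (\sum_k p^`M(k).@[x] * d k) + e ^+ 2 * q.[e].
apply: (mpoly_semiring_ind (fun=> True) P) => //.
- exists 0 => e; rewrite !raddf0 horner0 big1 ?mulr0 ?addr0 // => k _.
  by rewrite !raddf0 mul0r.
- exists 0 => e; rewrite !meval1 horner0 big1 ?mulr0 ?addr0 // => k _.
  by rewrite -mpolyC1 mderivC raddf0 mul0r.
- move=> c _; exists 0 => e; rewrite !mevalC horner0 big1 ?mulr0 ?addr0 // => k _.
  by rewrite mderivC raddf0 mul0r.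
- move=> i; exists 0 => e; rewrite !mevalXU horner0 mulr0 addr0.
  rewrite (bigD1 i) //= big1 ?addr0.
    have subUU : (U_(i) - U_(i) = 0 :> 'X_{1..n})%MM.
      by apply/mnmP => k; rewrite mnmBE subnn mnm0E.
    by rewrite mderivX mnm1E eqxx scale1r subUU mpolyX0 meval1 mul1r.
  by move=> k ki; rewrite mderivX mnm1E eq_sym (negbTE ki) scale0r raddf0 mul0r.
- move=> p1 p2 [q1 E1] [q2 E2]; exists (q1 + q2) => e.
  rewrite !mevalD E1 E2 hornerD.
  under [X in _ = _ + _ * X + _]eq_bigr do rewrite mderivD mevalD mulrDl.
  by rewrite big_split /=; ring.
- move=> p1 p2 [q1 E1] [q2 E2].
  set D1 := \sum_k p1^`M(k).@[x] * d k in E1.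
  set D2 := \sum_k p2^`M(k).@[x] * d k in E2.
  (* The terms of order at least 2 in the product of the two expansions, divided by [e ^+ 2]. *)
  exists (p1.@[x] *: q2 + p2.@[x] *: q1 + (D1 * D2)%:P + D1 *: ('X * q2)
          + D2 *: ('X * q1) + 'X ^+ 2 * (q1 * q2)) => e.
  rewrite !mevalM E1 E2 !hornerE.
  under [X in _ = _ + _ * X + _]eq_bigr
    do rewrite mderivM mevalD !mevalM mulrDl mulrAC -[X in _ + X]mulrA.
  rewrite big_split /= -mulr_suml -mulr_sumr -/D1 -/D2.
  ring.
Qed.

Lemma meval_differentiable {R : realFieldType} {n : nat} (x d : 'I_n -> R)
    (p : {mpoly R[n]}) (eta : R) : 0 < eta ->
  exists2 r, 0 < r & forall e, `|e| <= r ->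
    `|p.@[fun i => x i + e * d i] - p.@[x] - e * (\sum_k p^`M(k).@[x] * d k)|
      <= eta * `|e|.
Proof.
move=> eta0; have [q Eq] := meval_taylor1 x d p.
have [C HC] := poly_disk_bound q 1.
have C0 : 0 <= C by apply: le_trans (HC 0 _); rewrite ?normr0.
(* The 1 keeps [e] in the disk where [C] bounds [q]; then [|e| * C <= eta], and [C + 1] is positive
   even if [C = 0]. *)
exists (Num.min 1 (eta / (C + 1))).
  by rewrite lt_min ltr01 divr_gt0 // ltr_wpDl.
move=> e; rewrite le_min ler_pdivlMr ?ltr_wpDl // => /andP[e1 eC].
rewrite Eq [X in `|X|](_ : _ = e ^+ 2 * q.[e]); last by ring.
rewrite normrM normrX; have := HC e e1; have := normr_ge0 e; have := normr_ge0 q.[e].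
move: `|e| `|q.[e]| eC => a b; nra.
Qed.

(** Nonnegative coefficients make [p] convex along nonnegative directions, so beyond parameter 1 it
    lies above its secant through parameters 0 and 1. *)
Lemma meval_ray_convex {R : realFieldType} {n : nat} (p : {mpoly R[n]})
    (x d : 'I_n -> R) (t : R) :
  (forall m, 0 <= p@_m) -> (forall i, 0 <= x i) -> (forall i, 0 <= d i) ->
  1 <= t ->
  p.@[x] + t * (p.@[fun i => x i + d i] - p.@[x])
    <= p.@[fun i => x i + t * d i].
Proof.
move=> p0 x0 d0 t1.
pose P (q : {mpoly R[n]}) :=
  (* Nonnegativity and monotonicity are carried along for the product case: the product of two
     secants exceeds the secant of the product by [t * (t - 1) * (a' - a) * (b' - b)]. *)
  [/\ 0 <= q.@[x], q.@[x] <= q.@[fun i => x i + d i] &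
    q.@[x] + t * (q.@[fun i => x i + d i] - q.@[x])
      <= q.@[fun i => x i + t * d i]].
suff [] : P p by [].
move: p p0; apply: (mpoly_semiring_ind (fun c => 0 <= c) P); rewrite /P.
- by rewrite !raddf0; split => //; lra.
- by rewrite !meval1; split => //; lra.
- by move=> c c0; rewrite !mevalC; split => //; lra.
- by move=> i; rewrite !mevalXU; have := x0 i; have := d0 i; split => //; lra.
- move=> p q [p0 pd pt] [q0 qd qt]; rewrite !mevalD; split; lra.
- move=> p q; rewrite !mevalM.
  set a := p.@[x]; set a' := p.@[_]; set a'' := p.@[_].
  set b := q.@[x]; set b' := q.@[_]; set b'' := q.@[_].
  move=> [a0 aa at'] [b0 bb bt]; split; first exact: mulr_ge0.
    exact: ler_pM.
  have ta : 0 <= a + t * (a' - a) by nra.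
  have tb : 0 <= b + t * (b' - b) by nra.
  apply: le_trans (ler_pM ta tb at' bt).
  have : 0 <= (a' - a) * (b' - b) * (t * (t - 1)).
    by rewrite !mulr_ge0 ?subr_ge0 //; lra.
  lra.
Qed.

Lemma finite_pos_lbound {R : realFieldType} {I : finType} (c : I -> R) :
  (forall i, 0 < c i) -> exists2 r, 0 < r & forall i, r <= c i.
Proof.
(* The default 1 keeps the bound positive when [I] is empty. *)
move=> c0; exists (\big[Num.min/1]_i c i); last by move=> i; exact: bigmin_le.
by apply: (big_ind (fun a => 0 < a)) => // a b a0 b0; rewrite lt_min a0.
Qed.

(** * Pre-fixed points and the enclosure of the least fixed point *)

Section PPS.
Context {R : realType} {J : finType} (f : pps R J).

Let F (x : J -> R) (j : J) : R := (f j).@[fun i => x (enum_val i)].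

(** Knaster-Tarski: the infimum [nu] of all pre-fixed points is itself a fixed point, so [mu f] lies
    below it. *)
Lemma mu_le_prefix (x : J -> \bar R) :
  vnonnege x -> vle (pps_eval f x) x -> vle (mu f) x.
Proof.
pose P := [set y | vnonnege y /\ vle (pps_eval f y) y]%classic.
pose nu j := ereal_inf [set y j | y in P]%classic.
have nu_le y : P y -> vle nu y.
  by move=> Py j; apply: ereal_inf_lbound; exists y.
have nu0 : vnonnege nu.
  by move=> j; apply: le_ereal_inf_tmp => _ [y [y0 _] <-].
have fnu : vle (pps_eval f nu) nu.
  move=> j; apply: le_ereal_inf_tmp => _ [y Py <-].
  by apply: le_trans (Py.2 j); apply: pps_eval_mono => //; exact: nu_le.
have nu_fix : pps_eval f nu = nu.
  apply/funext => j; apply/le_anti; rewrite fnu /=.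
  apply: nu_le; split; first exact: pps_eval_ge0.
  by apply: pps_eval_mono => //; exact: pps_eval_ge0.
move=> x0 fx j; have [_ _ mu_least] := mu_lfp f.
exact: le_trans (mu_least nu nu0 nu_fix j) (nu_le x (conj x0 fx) j).
Qed.

Lemma mu_fin : feasible f -> exists m : J -> R, mu f = vEFin m.
Proof.
by move=> ff; exists (fun j => fine (mu f j)); apply/funext => j; rewrite /vEFin fineK.
Qed.

Lemma pval_mono (x y : J -> R) :
  vnonneg x -> vle x y -> vle (F x) (F y).
Proof.
move=> x0 xy j; rewrite -lee_fin -!pps_evalEFin; apply: pps_eval_mono.
  by move=> i; rewrite lee_fin; exact: x0.
by move=> i; rewrite lee_fin; exact: xy.
Qed.

Lemma pval_fix (m : J -> R) : mu f = vEFin m -> F m = m.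
Proof.
move=> mE; have [_ fix_mu _] := mu_lfp f.
apply/funext => j; apply: EFin_inj.
by rewrite -pps_evalEFin -mE fix_mu mE.
Qed.

Lemma mu_between (l u : J -> R) :
  vnonneg l -> vnonneg u ->
  vle (vEFin l) (pps_eval f (vEFin l)) -> vle l u ->
  vlt (pps_eval f (vEFin u)) (vEFin u) ->
  vle (vEFin l) (mu f) /\ vlt (mu f) (vEFin u).
Proof.
move=> l0 u0 lf lu fu.
have [mu0 fix_mu _] := mu_lfp f.
have mu_u : vle (mu f) (vEFin u).
  apply: mu_le_prefix => j; first by rewrite lee_fin; exact: u0.
  exact: ltW.
(* Applying [f] once makes the bound strict: [mu f = f (mu f) <= f u < u]. *)
have mu_lt_u : vlt (mu f) (vEFin u).
  move=> j; apply: le_lt_trans (fu j); rewrite -[X in (X j <= _)%O]fix_mu.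
  exact: pps_eval_mono.
split => //.
have [m mE] : exists m : J -> R, mu f = vEFin m.
  apply: mu_fin => j; rewrite ge0_fin_numE //.
  by apply: lt_le_trans (mu_lt_u j) _; exact: leey.
have m0 j : 0 <= m j by rewrite -lee_fin; have := mu0 j; rewrite mE.
have m_lt_u j : m j < u j by rewrite -lte_fin; have := mu_lt_u j; rewrite mE.
have Fm := pval_fix m mE.
have lF : vle l (F l) by move=> j; rewrite -lee_fin -pps_evalEFin; exact: lf.
have Fu j : F u j < u j by rewrite -lte_fin -pps_evalEFin; exact: fu.
rewrite mE => j0; rewrite lee_fin leNgt; apply/negP => ml0.
(* The maximum is still a post-fixed point, and its offset [d] from [m] is nonnegative, as convexity
   along the ray requires. *)
pose l' j := Num.max (l j) (m j); pose d j := l' j - m j.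
have d0 j : 0 <= d j by rewrite subr_ge0 le_max lexx orbT.
have l'E : l' = (fun j => m j + d j) by apply/funext => j; rewrite /d subrKC.
have l'F j : l' j <= F l' j.
  rewrite ge_max; apply/andP; split.
    apply: le_trans (lF j) _; apply: pval_mono => // k.
    by rewrite le_max lexx.
  rewrite -[X in X j <= _]Fm; apply: pval_mono => // k.
  by rewrite le_max lexx orbT.
have dj0 : 0 < d j0 by rewrite subr_gt0 lt_max ml0.
(* [j] is the coordinate in which the ray [m + t d] first reaches [u], and [t] the parameter at
   which it does; [t >= 1] because [l' <= u]. *)
have [j dj jmin] := @Order.TotalTheory.arg_minP _ _ _ j0 (fun j => 0 < d j)
  (fun j => (u j - m j) / d j) dj0.
set t := (u j - m j) / d j in jmin.
have t1 : 1 <= t.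
  rewrite ler_pdivlMr // mul1r lerB // ge_max (lu j) /=; exact: ltW.
have tu : vle (fun k => m k + t * d k) u.
  move=> k; have [dk|] := ltP 0 (d k).
    by rewrite -lerBrDl -ler_pdivlMr //; exact: jmin.
  move=> dk; have -> : d k = 0 by apply/le_anti; rewrite dk d0.
  by rewrite mulr0 addr0 ltW.
have tge k : 0 <= m k + t * d k.
  exact: addr_ge0 (m0 k) (mulr_ge0 (le_trans ler01 t1) (d0 k)).
(* In coordinate [j], [F u >= F (m + t d) >= m + t (F l' - m) >= m + t d = u], against [F u < u]. *)
have := meval_ray_convex (f j) _ _ _ (pps_ge0 f j) (fun i => m0 (enum_val i))
  (fun i => d0 (enum_val i)) t1.
have := pval_mono _ _ tge tu j; have := l'F j; have := Fu j.
have Fmj : (f j).@[fun i => m (enum_val i)] = m j by rewrite -[RHS](congr1 (@^~ j) Fm).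
rewrite Fmj /F l'E.
have tE : t * d j = u j - m j by rewrite divfK // gt_eqF.
nra.
Qed.

(** * First-order behaviour of the system *)

Let D (m d : J -> R) (j : J) : R :=
  \sum_k (f j)^`M(k).@[fun i => m (enum_val i)] * d (enum_val k).

Lemma pval_differentiable (m d : J -> R) (eta : R) : 0 < eta ->
  exists2 r, 0 < r & forall e j, `|e| <= r ->
    `|F (fun k => m k + e * d k) j - F m j - e * D m d j| <= eta * `|e|.
Proof.
move=> eta0.
have /choice[r Hr] j : exists r, 0 < r /\ forall e, `|e| <= r ->
    `|F (fun k => m k + e * d k) j - F m j - e * D m d j| <= eta * `|e|.
  have [r r0 Hr] := meval_differentiable (fun i => m (enum_val i))
    (fun i => d (enum_val i)) (f j) eta eta0.
  by exists r.
have [s s0 sr] := finite_pos_lbound r (fun j => (Hr j).1).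
by exists s => // e j es; apply: (Hr j).2; exact: le_trans es (sr j).
Qed.

(** Keeps [m - e d] nonnegative for small [e]; with a constant in place of [m] it also bounds the
    width of the final enclosure. *)
Lemma exists_scale (m d : J -> R) : (forall j, 0 < m j) ->
  exists2 r, 0 < r & forall e j, 0 <= e <= r -> e * d j <= m j.
Proof.
move=> m0; have [r r0 rm] := finite_pos_lbound (fun j => m j / (`|d j| + 1))
  (fun j => divr_gt0 (m0 j) (ltr_wpDl (normr_ge0 (d j)) ltr01)).
exists r => // e j /andP[e0 er]; have := rm j.
rewrite ler_pdivlMr ?ltr_wpDl //; have := ler_norm (d j).
have := normr_ge0 (d j); move: (d j) => a; nra.
Qed.

(** * The Jacobian at a positive least fixed point and rational bounds *)

Section Positive.
Variable (m : J -> R).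
Hypotheses (mE : mu f = vEFin m) (m0 : forall j, 0 < m j).

Lemma jacobian_no_growth (v : J -> R) : vnonneg v ->
  (forall j, 0 < v j -> v j + 1 <= D m v j) -> forall j, v j = 0.
Proof.
move=> v0 vD; have Fm := pval_fix m mE.
(* The tolerance 1 is exactly the slack in [v j + 1 <= D m v j]. *)
have [r r0 Hr] := pval_differentiable m v 1 ltr01.
have [s s0 Hs] := exists_scale m v m0.
pose e := Num.min r s.
have e0 : 0 < e by rewrite lt_min r0.
have es j : e * v j <= m j by apply: Hs; rewrite ltW //= ge_min lexx orbT.
pose w k := m k + (- e) * v k.
have w0 : vnonneg w by move=> k; rewrite /w mulNr subr_ge0.
have wm : vle w m by move=> k; rewrite /w mulNr gerBl mulr_ge0 // ltW.
(* Off the support of [v], [w] agrees with [m] and monotonicity suffices; on it,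
   [F w <= m - e (v + 1) + e = w]. *)
have Fw j : F w j <= w j.
  have := v0 j; rewrite le_eqVlt => /predU1P[vj|vj].
    have := pval_mono _ _ w0 wm j; rewrite Fm => /le_trans; apply.
    by rewrite /w -vj mulr0 addr0.
  have := Hr (- e) j; rewrite normrN gtr0_norm // ge_min lexx => /(_ isT).
  rewrite -/w Fm ler_norml => /andP[_]; have := vD j vj; rewrite /w; nra.
move=> j; have := mu_le_prefix (vEFin w); rewrite mE => /(_ _ _ j) H.
have : m j <= w j.
  rewrite -lee_fin; apply: H => k; first by rewrite lee_fin; exact: w0.
  by rewrite pps_evalEFin lee_fin; exact: Fw.
by have := v0 j; rewrite /w; nra.
Qed.

Lemma pderiv_ge0 j k : 0 <= (f j)^`M(k).@[fun i => m (enum_val i)].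
Proof.
rewrite mevalE sumr_ge0 // => n _; apply: mulr_ge0.
  by rewrite mcoeff_deriv mulrn_wge0 // pps_ge0.
by rewrite prodr_ge0 // => i _; rewrite exprn_ge0 // ltW.
Qed.

Lemma jacobian_direction :
  1%:M - pps_jacobian f m \in unitmx ->
  exists d : J -> R, forall j, 1 <= d j /\ D m d j = d j - 1.
Proof.
move=> unitA.
have [x Ax] : exists x : 'cV[R]_#|J|, (1%:M - pps_jacobian f m) *m x = const_mx 1.
  by exists (invmx (1%:M - pps_jacobian f m) *m const_mx 1); exact: mulKVmx.
pose d j := x (enum_rank j) 0.
have dD j : D m d j = d j - 1.
  move/matrixP/(_ (enum_rank j) 0): Ax; rewrite mulmxBl mul1mx !mxE -/(d j).
  rewrite (eq_bigr (fun k => (f j)^`M(k).@[fun i => m (enum_val i)] * d (enum_val k))).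
    by rewrite -/(D m d j) => <-; ring.
  by move=> k _; rewrite mxE enum_rankK /d enum_valK.
(* Since the Jacobian is entrywise nonnegative, wherever [v j > 0] it sends [v] to at least
   [- D m d j = 1 - d j = v j + 1]. *)
pose v j := Num.max 0 (- d j).
have v0 : vnonneg v by move=> j; rewrite le_max lexx.
have Dv j : - D m d j <= D m v j.
  rewrite -sumrN; apply: ler_sum => k _; rewrite -mulrN.
  by apply: ler_wpM2l; [exact: pderiv_ge0 | rewrite le_max lexx orbT].
have vz : forall j, v j = 0.
  apply: jacobian_no_growth => // j vj; have := Dv j; rewrite dD.
  have : v j <= - d j.
    by move: vj; rewrite /v lt_max ltxx /= => /ltW nd; rewrite ge_max nd lexx.
  lra.
have dge0 : vnonneg d.
  by move=> j; rewrite -oppr_le0 -(vz j) le_max lexx orbT.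
(* Once [d >= 0], [d - 1 = D m d >= 0] improves this to [d >= 1]. *)
exists d => j; split => //; rewrite -subr_ge0 -dD sumr_ge0 // => k _.
by apply: mulr_ge0; [exact: pderiv_ge0 | exact: dge0].
Qed.

(** With error at most [e / 4], [F (m - e d) >= m - e (d - 1) - e / 4 = m - e d + 3 e / 4], and
    symmetrically above [m]. A rational point within [e / 2] of [m - e d] or [m + e d], on the side
    of [m], thus keeps its inequality. *)
Lemma rational_approx (eps : R) :
  1%:M - pps_jacobian f m \in unitmx -> 0 < eps ->
  exists lq uq : J -> rat,
    let l : J -> R := vratr R lq in
    let u : J -> R := vratr R uq in
    [/\ vnonneg lq /\ vnonneg uq,
        vle (vEFin l) (pps_eval f (vEFin l)),
        vle l u,
        vlt (pps_eval f (vEFin u)) (vEFin u) &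
        supnorm (fun j => l j - u j) <= eps].
Proof.
move=> unitA eps0; have [d dP] := jacobian_direction unitA.
have Fm := pval_fix m mE.
have [r r0 Hr] := pval_differentiable m d (1 / 4) (divr_gt0 ltr01 (ltr0Sn R 3)).
have [s s0 Hs] := exists_scale m d m0.
(* The width [u - l] is below [2 e d], so [e d <= eps / 2] is enough. *)
have [t t0 Ht] := exists_scale (fun=> eps / 2) d (fun=> divr_gt0 eps0 (ltr0Sn R 1)).
pose e := Num.min r (Num.min s t).
have e0 : 0 < e by rewrite !lt_min r0 s0.
have er : `|e| <= r by rewrite gtr0_norm // ge_min lexx.
have em j : e * d j <= m j by apply: Hs; rewrite ltW //= !ge_min lexx orbT.
have eeps j : e * d j <= eps / 2 by apply: Ht; rewrite ltW //= !ge_min lexx !orbT.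
(* From [d >= 1]: the two intervals of length [e / 2] chosen next do not cross, and the upper one
   stays positive. *)
have edge j : e <= e * d j by rewrite ler_peMr ?(dP j).1 // ltW.
have /choice[lq Hl] j : exists q : rat,
    m j - e * d j < ratr q < m j - e * d j + e / 2.
  have [|q] := @rat_in_itvoo R (m j - e * d j) (m j - e * d j + e / 2); first by lra.
  by rewrite in_itv /=; exists q.
have /choice[uq Hu] j : exists q : rat,
    m j + e * d j - e / 2 < ratr q < m j + e * d j.
  have [|q] := @rat_in_itvoo R (m j + e * d j - e / 2) (m j + e * d j); first by lra.
  by rewrite in_itv /=; exists q.
have lge0 j : 0 <= ratr (lq j) :> R by have := Hl j; have := em j; lra.
have uge0 j : 0 <= ratr (uq j) :> R.
  by have := Hu j; have := edge j; have := m0 j; lra.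
exists lq, uq => l u; split.
- by split=> j; rewrite -(ler0q R).
- move=> j; rewrite pps_evalEFin lee_fin -/(F l j).
  have : F (fun k => m k + (- e) * d k) j <= F l j.
    apply: pval_mono => k; rewrite mulNr ?subr_ge0 //.
    by have /andP[/ltW] := Hl k.
  have := Hr (- e) j; rewrite normrN => /(_ er); rewrite (gtr0_norm e0) Fm (dP j).2.
  by rewrite ler_norml; have := Hl j; rewrite /l /vratr; lra.
- by move=> j; have := Hl j; have := Hu j; have := edge j; rewrite /l /u /vratr; lra.
- move=> j; rewrite pps_evalEFin lte_fin -/(F u j).
  have : F u j <= F (fun k => m k + e * d k) j.
    apply: pval_mono => k; first exact: uge0.
    by have /andP[_ /ltW] := Hu k.
  have := Hr e j er; rewrite (gtr0_norm e0) Fm (dP j).2.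
  by rewrite ler_norml; have := Hu j; rewrite /u /vratr; lra.
- apply: bigmax_le => [|j _]; first exact: ltW.
  by rewrite ler_norml; have := Hl j; have := Hu j; have := eeps j;
    have := edge j; rewrite /l /u /vratr; lra.
Qed.

End Positive.
End PPS.

Theorem theorem5 (R : realType) (J : finType) (f : pps R J) :
  (forall l u : J -> R, vnonneg l -> vnonneg u ->
     vle (vEFin l) (pps_eval f (vEFin l)) ->
     vle l u ->
     vlt (pps_eval f (vEFin u)) (vEFin u) ->
     vle (vEFin l) (mu f) /\ vlt (mu f) (vEFin u)) /\
  (feasible f -> nonsingular f -> clean f ->
   forall eps : R, 0 < eps ->
   exists lq uq : J -> rat,
     let l : J -> R := vratr R lq in
     let u : J -> R := vratr R uq in
     [/\ vnonneg lq /\ vnonneg uq,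
         vle (vEFin l) (pps_eval f (vEFin l)),
         vle l u,
         vlt (pps_eval f (vEFin u)) (vEFin u) &
         supnorm (fun j => l j - u j) <= eps]).
Proof.
split; first exact: mu_between.
move=> ff [_ unitA] cf eps eps0.
apply: (rational_approx f (fun j => fine (mu f j))) => // [|j].
  by apply/funext => j; rewrite /vEFin fineK.
by rewrite fine_gt0 // cf -ge0_fin_numE; [exact: ff | exact: ltW].
Qed.
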